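(* Let $E\subset F$ be a subobject in $\mathrm{Bmod}^{\mathfrak s}$ containing $F^\sigma$, and let $E^c:=F\setminus E$. Then the cokernel of the inclusion $E\subset F$ is the quotient of $F^\sigma\cup E^c$ by the smallest equivalence relation such that $$\xi\in E^c,\ u,v\in E,\ p(u)=p(v)\ \Longrightarrow\ \xi+u\sim\xi+v,$$ where an element $\xi+u$ (or $\xi+v$) that happens to lie in $E$ is to be replaced by $p(\xi+u)\in F^\sigma$ (resp. $p(\xi+v)$). The cokernel map is the quotient map on $E^c$ and (the class of) the projection $p$ on $E$.
   Context: $\mathbb B=\{0,1\}$ is the Boolean semifield ($1+1=1$). A $\mathbb B$-module is a commutative monoid $(M,+,0)$ with $x+x=x$ for all $x$; morphisms are the monoid homomorphisms. $\mathrm{Bmod}^{\mathfrak s}$ is the category of $\mathbb B$-modules endowed with an involution $\sigma$ (an endomorphism with $\sigma^2=\mathrm{id}$), with morphisms the $\mathbb B$-module morphisms commuting with $\sigma$. A subobject is a $\sigma$-invariant submodule. $F^\sigma$ is the set of fixed points of $\sigma$ in $F$, and $p(x):=x+\sigma(x)\in F^\sigma$. For $h:L\to M$ in $\mathrm{Bmod}^{\mathfrak s}$, $\mathrm{Ker}(h):=h^{-1}(M^\sigma)$, and the cokernel is $\mathrm{Coker}(h):=M/\!\sim_{\mathrm{cok}}$ (with induced addition and involution), together with the quotient map $M\to\mathrm{Coker}(h)$ (the cokernel map), where $b\sim_{\mathrm{cok}} b'$ iff $g(b)=g(b')$ for every object $X$ and every morphism $g:M\to X$ of $\mathrm{Bmod}^{\mathfrak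 s}$ with $\mathrm{Range}(h)\subset\mathrm{Ker}(g)$. The $\mathbb B$-module structure and involution on the quotient of $F^\sigma\cup E^c$ are those for which the described surjection from $F$ is a morphism; the assertion is that these exist and that this surjection is the cokernel of the inclusion. *)

(* Defs.v *)
From HB Require Import structures.
From mathcomp Require Import all_boot all_algebra.
From mathcomp Require Import boolp.

Set Implicit Arguments.
Unset Strict Implicit.
Unset Printing Implicit Defensive.

Import GRing.Theory.

Local Open Scope ring_scope.
Local Open Scope quotient_scope.

(* The choice structure contained in nmodType is no restriction in the
   classical setting of boolp. *)
HB.mixin Record Nmodule_isBModule M & GRing.Nmodule M := {
  addxx : idempotent_op (+%R : M -> M -> M)
}.

#[short(type="bmodType")]
HB.structure Definition BModule := {M of GRing.Nmodule M & Nmodule_isBModule M}.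

HB.mixin Record BModule_isSBModule M & BModule M := {
  sigma : M -> M;
  sigma_nmod_morphism : nmod_morphism sigma;
  sigmaK : involutive sigma
}.

#[short(type="sbmodType")]
HB.structure Definition SBModule := {M of BModule M & BModule_isSBModule M}.

HB.mixin Record isSigmaEquivariant (L M : sbmodType) (h : L -> M) := {
  sigma_equivariant : {morph h : x / sigma x}
}.

#[short(type="sbHom")]
HB.structure Definition SBMorphism (L M : sbmodType) :=
  {h of GRing.isNmodMorphism L M h & isSigmaEquivariant L M h}.

HB.mixin Record isSigmaClosed (F : sbmodType) (E : {pred F}) := {
  sigma_closed : {in E, forall x, sigma x \in E}
}.

(* Classically, boolean predicates on F are arbitrary subsets of F. *)
#[short(type="sbSub")]
HB.structure Definition SBSubobject (F : sbmodType) :=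
  {E of GRing.isAddClosed F E & isSigmaClosed F E}.

Section FixedPoints.
Variable F : sbmodType.
Implicit Types x y : F.

Definition fixed : {pred F} := [pred x | sigma x == x].

Definition sbproj x : F := x + sigma x.

Lemma sigma0 : sigma (0 : F) = 0.
Proof. by have [] := @sigma_nmod_morphism F. Qed.

Lemma sigmaD x y : sigma (x + y) = sigma x + sigma y.
Proof. by have [_] := @sigma_nmod_morphism F; apply. Qed.

Lemma sbproj_fixed x : sbproj x \in fixed.
Proof. by rewrite inE /sbproj sigmaD sigmaK addrC. Qed.

End FixedPoints.

Arguments fixed F : clear implicits.

Definition ker (L M : sbmodType) (h : L -> M) : {pred L} :=
  [pred x | h x \in fixed M].

Section Subobject.
Variables (F : sbmodType) (E : sbSub F).

Record subobj := Subobj { incl : F; _ : incl \in E }.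

HB.instance Definition _ := [isSub for incl].
HB.instance Definition _ := [Choice of subobj by <:].

Fact subobj_nmod_closed : GRing.nmod_closed [in E].
Proof. by split=> [|x y]; [exact: rpred0 | exact: rpredD]. Qed.

HB.instance Definition _ :=
  GRing.SubChoice_isSubNmodule.Build F _ subobj subobj_nmod_closed.

Fact incl_nmod_morphism : nmod_morphism incl.
Proof.
split; first exact: (raddf0 (val : subobj -> F)).
exact: (raddfD (val : subobj -> F)).
Qed.

Fact subobj_addxx : idempotent_op (+%R : subobj -> subobj -> subobj).
Proof. by move=> x; apply: val_inj; rewrite raddfD /= addxx. Qed.

HB.instance Definition _ := Nmodule_isBModule.Build subobj subobj_addxx.

Definition subobj_sigma (x : subobj) : subobj := Subobj (sigma_closed _ (valP x)).

Fact subobj_sigma_nmod_morphism : nmod_morphism subobj_sigma.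
Proof.
split=> [|x y]; apply: val_inj; rewrite [LHS]/=.
  by rewrite (raddf0 (val : subobj -> F)) sigma0.
by rewrite !(raddfD (val : subobj -> F)) sigmaD.
Qed.

Fact subobj_sigmaK : involutive subobj_sigma.
Proof. by move=> x; apply: val_inj; rewrite /= sigmaK. Qed.

HB.instance Definition _ := BModule_isSBModule.Build subobj
  subobj_sigma_nmod_morphism subobj_sigmaK.

HB.instance Definition _ :=
  GRing.isNmodMorphism.Build subobj F incl incl_nmod_morphism.
HB.instance Definition _ :=
  isSigmaEquivariant.Build subobj F incl (fun=> erefl).

End Subobject.

Section Cokernel.
Variables (L M : sbmodType) (h : sbHom L M).

(* X ranges over a fixed universe, which contains M and its quotients. *)
Definition cokrel : rel M := fun b b' =>
  `[< forall (X : sbmodType) (g : sbHom M X),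
        (forall a, h a \in ker g) -> g b = g b' >].

Lemma cokrelP b b' :
  reflect (forall (X : sbmodType) (g : sbHom M X),
             (forall a, h a \in ker g) -> g b = g b') (cokrel b b').
Proof. exact: asboolP. Qed.

Fact cokrel_refl : reflexive cokrel.
Proof. by move=> b; apply/cokrelP. Qed.

Fact cokrel_sym : symmetric cokrel.
Proof. by move=> b c; apply/cokrelP/cokrelP => bc X g hg; rewrite (bc X g hg). Qed.

Fact cokrel_trans : transitive cokrel.
Proof.
move=> c b d /cokrelP bc /cokrelP cd.
by apply/cokrelP => X g hg; rewrite (bc X g hg) (cd X g hg).
Qed.

Canonical cokrel_equiv := EquivRel cokrel cokrel_refl cokrel_sym cokrel_trans.

Definition coker := {eq_quot cokrel_equiv}.
HB.instance Definition _ := Choice.on coker.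

Definition cokmap (b : M) : coker := \pi_{eq_quot cokrel_equiv} b.

Lemma cokmapP b b' : cokmap b = cokmap b' <-> cokrel b b'.
Proof. by split=> [/eqmodP|?]; last apply/eqmodP. Qed.

Lemma cokmap_repr (q : coker) :
  cokmap (repr (q : {eq_quot cokrel_equiv})) = q.
Proof. exact: reprK. Qed.

Lemma cokrelD b b' c c' : cokrel b b' -> cokrel c c' -> cokrel (b + c) (b' + c').
Proof.
move=> /cokrelP bb' /cokrelP cc'; apply/cokrelP => X g hg.
by rewrite !raddfD /= (bb' X g hg) (cc' X g hg).
Qed.

Lemma cokrel_sigma b b' : cokrel b b' -> cokrel (sigma b) (sigma b').
Proof.
move=> /cokrelP bb'; apply/cokrelP => X g hg.
by rewrite !sigma_equivariant /= (bb' X g hg).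
Qed.

Definition coker_add (p q : coker) : coker :=
  cokmap (repr (p : {eq_quot cokrel_equiv}) + repr (q : {eq_quot cokrel_equiv})).

Definition coker_sigma (p : coker) : coker :=
  cokmap (sigma (repr (p : {eq_quot cokrel_equiv}))).

Lemma cokmapD b c : cokmap (b + c) = coker_add (cokmap b) (cokmap c).
Proof.
by apply/cokmapP/cokrelD; apply/cokmapP; rewrite cokmap_repr.
Qed.

Lemma cokmap_sigma b : cokmap (sigma b) = coker_sigma (cokmap b).
Proof. by apply/cokmapP/cokrel_sigma/cokmapP; rewrite cokmap_repr. Qed.

Lemma cokmap_ind (P : coker -> Prop) : (forall b, P (cokmap b)) -> forall q, P q.
Proof. by move=> Pb q; rewrite -(cokmap_repr q). Qed.

Fact coker_addA : associative coker_add.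
Proof.
elim/cokmap_ind=> a; elim/cokmap_ind=> b; elim/cokmap_ind=> c.
by rewrite -!cokmapD addrA.
Qed.

Fact coker_addC : commutative coker_add.
Proof.
by elim/cokmap_ind=> a; elim/cokmap_ind=> b; rewrite -!cokmapD addrC.
Qed.

Fact coker_add0 : left_id (cokmap 0) coker_add.
Proof. by elim/cokmap_ind=> a; rewrite -cokmapD add0r. Qed.

HB.instance Definition _ :=
  GRing.isNmodule.Build coker coker_addA coker_addC coker_add0.

Fact coker_addxx : idempotent_op (+%R : coker -> coker -> coker).
Proof. by elim/cokmap_ind=> a; rewrite -[LHS]cokmapD addxx. Qed.

HB.instance Definition _ := Nmodule_isBModule.Build coker coker_addxx.

Fact coker_sigma_nmod_morphism : nmod_morphism coker_sigma.
Proof.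
split=> [|]; first by rewrite -[LHS]cokmap_sigma sigma0.
elim/cokmap_ind=> a; elim/cokmap_ind=> b.
by rewrite -[_ + _]cokmapD -!cokmap_sigma sigmaD cokmapD.
Qed.

Fact coker_sigmaK : involutive coker_sigma.
Proof. by elim/cokmap_ind=> a; rewrite -!cokmap_sigma sigmaK. Qed.

HB.instance Definition _ := BModule_isSBModule.Build coker
  coker_sigma_nmod_morphism coker_sigmaK.

Fact cokmap_nmod_morphism : nmod_morphism cokmap.
Proof. by split=> // a b; exact: cokmapD. Qed.

HB.instance Definition _ :=
  GRing.isNmodMorphism.Build M coker cokmap cokmap_nmod_morphism.
HB.instance Definition _ :=
  isSigmaEquivariant.Build M coker cokmap cokmap_sigma.

End Cokernel.

Section SmallestEquivalence.
Variables (T : Type) (r : T -> T -> Prop).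

Definition smallest_equiv : rel T := fun x y =>
  `[< forall e : equiv_rel T, (forall a b, r a b -> e a b) -> e x y >].

Fact smallest_equiv_refl : reflexive smallest_equiv.
Proof. by move=> x; apply/asboolP => e _; exact: equiv_refl. Qed.

Fact smallest_equiv_sym : symmetric smallest_equiv.
Proof.
by move=> x y; apply/asboolP/asboolP => xy e re; rewrite equiv_sym; apply: xy.
Qed.

Fact smallest_equiv_trans : transitive smallest_equiv.
Proof.
move=> y x z /asboolP xy /asboolP yz; apply/asboolP => e re.
exact: equiv_trans (xy e re) (yz e re).
Qed.

Canonical smallest_equiv_equiv :=
  EquivRel smallest_equiv
    smallest_equiv_refl smallest_equiv_sym smallest_equiv_trans.

End SmallestEquivalence.

Section Quotient.
Variables (F : sbmodType) (E : sbSub F).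

Definition fixedUcompl : {pred F} := [predU fixed F & [predC E]].

(* An element lying in E is replaced by its projection to F^sigma. *)
Definition reduce (x : F) : F := if x \in E then sbproj x else x.

Fact reduce_subproof x : reduce x \in fixedUcompl.
Proof.
rewrite /reduce !inE /=; case: ifPn => [_|->]; last by rewrite orbT.
by have := sbproj_fixed x; rewrite inE => ->.
Qed.

Definition to_fixedUcompl (x : F) : {y : F | y \in fixedUcompl} :=
  exist _ (reduce x) (reduce_subproof x).

Definition quot_gen (a b : {y : F | y \in fixedUcompl}) : Prop :=
  exists xi u v : F,
    [/\ xi \notin E, u \in E, v \in E, sbproj u = sbproj v &
        a = to_fixedUcompl (xi + u) /\ b = to_fixedUcompl (xi + v)].

Definition quot : Type := {eq_quot (smallest_equiv_equiv quot_gen)}.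

HB.instance Definition _ := Choice.on quot.

Definition quot_class (a : {y : F | y \in fixedUcompl}) : quot :=
  \pi_{eq_quot (smallest_equiv_equiv quot_gen)} a.

End Quotient.

(* Main.v *)
(* Write N x for the class of [reduce x].  The fibres of N are a congruence on
   F: adding z to both sides of a generator xi + u ~ xi + v gives the generator
   (xi + z) + u ~ (xi + z) + v or xi + (u + z) ~ xi + (v + z), unless z and
   xi + z lie outside and inside E respectively, in which case both sides lie
   in E and have the same projection.  So N is a morphism onto the quotient,
   and it sends E to fixed points.  Conversely a morphism g with E in its
   kernel satisfies g u = g (p u) on E, hence is constant on the fibres of N. *)
Require Import Defs.
From HB Require Import structures.
From mathcomp Require Import all_boot all_algebra.
From mathcomp Require Import boolp.

Set Implicit Arguments.
Unset Strict Implicit.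
Unset Printing Implicit Defensive.

Import GRing.Theory.

Local Open Scope ring_scope.
Local Open Scope quotient_scope.

(** * The projection p onto the fixed points *)

Section Projection.
Variable F : sbmodType.
Implicit Types x y : F.

Lemma sbprojD x y : sbproj (x + y) = sbproj x + sbproj y.
Proof. by rewrite /sbproj sigmaD addrACA. Qed.

Lemma sbproj_sigma x : sbproj (sigma x) = sbproj x.
Proof. by rewrite /sbproj sigmaK addrC. Qed.

Lemma sigma_sbproj x : sigma (sbproj x) = sbproj x.
Proof. exact/eqP/sbproj_fixed. Qed.

Lemma sbproj_id x : x \in fixed F -> sbproj x = x.
Proof. by rewrite inE /sbproj => /eqP->; rewrite addxx. Qed.

Lemma sbproj_idem x : sbproj (sbproj x) = sbproj x.
Proof. exact/sbproj_id/sbproj_fixed. Qed.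

End Projection.

(** * Generated equivalence relations *)

Section SmallestEquivalenceTheory.
Variables (T : Type) (r : T -> T -> Prop).

Lemma smallest_equiv_gen a b : r a b -> smallest_equiv r a b.
Proof. by move=> rab; apply/asboolP => e; apply. Qed.

(** The fibres of [f] form an equivalence relation containing [r], hence containing the smallest
    one. *)
Lemma smallest_equiv_fun (U : Type) (f : T -> U) a b :
    (forall c d, r c d -> f c = f d) -> smallest_equiv r a b -> f a = f b.
Proof.
pose e c d := `[< f c = f d >].
have e_refl : reflexive e by move=> c; apply/asboolP.
have e_sym : symmetric e by move=> c d; apply/asboolP/asboolP.
have e_trans : transitive e.
  by move=> d c c' /asboolP cd /asboolP dc'; apply/asboolP; rewrite cd.
move=> rf /asboolP/(_ (EquivRel e e_refl e_sym e_trans)) ab.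
by apply/asboolP/ab => c d /rf cd; apply/asboolP.
Qed.

End SmallestEquivalenceTheory.

(** * The class map N and its fibres *)

Section Subobject.
Variables (F : sbmodType) (E : sbSub F).
Implicit Types x y : F.

Lemma mem_sigma x : (sigma x \in E) = (x \in E).
Proof.
by apply/idP/idP => /(sigma_closed (s := E)) //; rewrite sigmaK.
Qed.

(** This is the map N described above, defined on all of [F]. *)
Definition reduce_class x : quot E := quot_class (to_fixedUcompl E x).

Lemma quot_class_eq (a b : {y : F | y \in fixedUcompl E}) :
  quot_class a = quot_class b <-> smallest_equiv (@quot_gen F E) a b.
Proof. by split=> [/eqmodP|?]; last apply/eqmodP. Qed.

Lemma reduce_class_gen xi u v :
    xi \notin E -> u \in E -> v \in E -> sbproj u = sbproj v ->
  reduce_class (xi + u) = reduce_class (xi + v).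
Proof.
move=> xiE uE vE puv; apply/quot_class_eq/smallest_equiv_gen.
by exists xi, u, v.
Qed.

(** Both elements are replaced by the same fixed point, so no generator is involved. *)
Lemma reduce_class_sbproj x y :
  x \in E -> y \in E -> sbproj x = sbproj y -> reduce_class x = reduce_class y.
Proof.
move=> xE yE pxy; rewrite /reduce_class; congr quot_class; apply: val_inj.
by rewrite /= /reduce xE yE.
Qed.

(** Elimination principle for the fibres of N: a map that ignores the replacement [reduce] is
    determined by its values on the union of the fixed points and the complement of [E], where only
    the generators remain to be checked. *)
Lemma reduce_class_fun (U : Type) (f : F -> U) :
    (forall x, f (reduce E x) = f x) ->
    (forall xi u v, xi \notin E -> u \in E -> v \in E ->
       sbproj u = sbproj v -> f (xi + u) = f (xi + v)) ->
  forall x y, reduce_class x = reduce_class y -> f x = f y.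
Proof.
move=> f_reduce f_gen x y /quot_class_eq xy.
rewrite -f_reduce -[RHS]f_reduce.
apply: (smallest_equiv_fun (f := f \o val)) xy => a b [xi [u [v []]]].
by move=> xiE uE vE puv [-> ->] /=; rewrite !f_reduce; apply: f_gen.
Qed.

(** Since [g u] is fixed, [g (sbproj u)] is [g u + g u], and addition is idempotent. *)
Lemma ker_incl_sbproj (X : sbmodType) (g : sbHom F X) u :
  (forall a, @incl F E a \in ker g) -> u \in E -> g (sbproj u) = g u.
Proof.
move=> gE uE; have := gE (Subobj uE); rewrite !inE /= => /eqP gu.
by rewrite raddfD /= sigma_equivariant gu addxx.
Qed.

Lemma reduce_class_cokrel x y :
  reduce_class x = reduce_class y -> cokrel (@incl F E) x y.
Proof.
move=> xy; apply/cokrelP => X g gE; move: x y xy.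
apply: reduce_class_fun => [x|xi u v xiE uE vE puv].
  by rewrite /reduce; case: ifP => // xE; apply: ker_incl_sbproj.
rewrite !raddfD /= -(ker_incl_sbproj gE uE) puv.
by rewrite (ker_incl_sbproj gE vE).
Qed.

Lemma reduce_id x : x \in fixedUcompl E -> reduce E x = x.
Proof.
rewrite /reduce; case: ifP => //= xE; rewrite !inE xE orbF => xF.
exact: sbproj_id.
Qed.

Lemma quot_classE a : quot_class a = reduce_class (val a) :> quot E.
Proof.
rewrite /reduce_class; congr quot_class; apply: val_inj.
by rewrite /= reduce_id ?(valP a).
Qed.

(** * The fibres of N are a congruence *)

Hypothesis FsigmaE : {subset fixed F <= E}.

Lemma sbproj_in x : sbproj x \in E.
Proof. exact/FsigmaE/sbproj_fixed. Qed.

Lemma reduce_classDl x y z :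
  reduce_class x = reduce_class y -> reduce_class (x + z) = reduce_class (y + z).
Proof.
move: x y; apply: reduce_class_fun => [x|xi u v xiE uE vE puv].
  (* For [x] in [E], replacing [x] by [sbproj x] must not change the class of the sum with [z]. If
     [z] is outside [E], it plays the role of [xi] in a generator with [u = sbproj x] and
     [v = x]. *)
  rewrite /reduce; case: ifP => // xE; have pE := sbproj_in x.
  have [zE|zE] := boolP (z \in E).
    apply: (reduce_class_sbproj (rpredD pE zE) (rpredD xE zE)).
    by rewrite !(sbprojD _ z) sbproj_idem.
  by rewrite ![_ + z]addrC; apply: reduce_class_gen; rewrite ?sbproj_idem.
have [zE|zE] := boolP (z \in E).
  rewrite -!addrA; apply: reduce_class_gen; rewrite ?rpredD //.
  by rewrite !sbprojD puv.
(* With [z] outside [E], it is absorbed into [xi]; this gives a generator unless [xi + z] falls into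
   [E]. *)
rewrite ![_ + _ + z]addrAC.
have [xizE|] := boolP (xi + z \in E); last by move/reduce_class_gen; apply.
apply: (reduce_class_sbproj (rpredD xizE uE) (rpredD xizE vE)).
by rewrite !(sbprojD (xi + z)) puv.
Qed.

(** The involution preserves [E], its complement and the values of [sbproj], so it maps generators
    to generators. *)
Lemma reduce_class_sigma x y :
    reduce_class x = reduce_class y ->
  reduce_class (sigma x) = reduce_class (sigma y).
Proof.
move: x y; apply: reduce_class_fun => [x|xi u v xiE uE vE puv].
  rewrite /reduce; case: ifP => // xE; apply: reduce_class_sbproj.
  - by rewrite sigma_sbproj sbproj_in.
  - by rewrite mem_sigma.
  - by rewrite !sbproj_sigma sbproj_idem.
by rewrite !sigmaD; apply: reduce_class_gen; rewrite ?mem_sigma ?sbproj_sigma.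
Qed.

End Subobject.

(* An alias of [quot E] that records the hypothesis on E, so that the module
   structure can be inferred canonically. *)
Definition cokernel_quot (F : sbmodType) (E : sbSub F)
  (FsigmaE : {subset fixed F <= E}) : Type := quot E.

(** * The induced structure on the quotient *)

Section QuotientModule.
Variables (F : sbmodType) (E : sbSub F) (FsigmaE : {subset fixed F <= E}).

Local Notation Q := (cokernel_quot FsigmaE).

HB.instance Definition _ := Choice.copy Q (quot E).

Definition quot_proj (x : F) : Q := reduce_class E x.

Definition quot_repr (q : Q) : F :=
  val (repr (q : {eq_quot (smallest_equiv_equiv (@quot_gen F E))})).

Lemma quot_reprK : cancel quot_repr quot_proj.
Proof.
by move=> q; rewrite /quot_proj -quot_classE /quot_class reprK.
Qed.

Lemma quot_proj_ind (P : Q -> Prop) :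
  (forall x, P (quot_proj x)) -> forall q, P q.
Proof. by move=> Px q; rewrite -(quot_reprK q). Qed.

Definition quot_add (p q : Q) : Q := quot_proj (quot_repr p + quot_repr q).
Definition quot_sigma (q : Q) : Q := quot_proj (sigma (quot_repr q)).

(** The summands are replaced by their representatives one at a time; commutativity reduces the
    second replacement to [reduce_classDl]. *)
Lemma quot_projD x y : quot_proj (x + y) = quot_add (quot_proj x) (quot_proj y).
Proof.
transitivity (quot_proj (quot_repr (quot_proj x) + y)).
  by apply: reduce_classDl => //; apply/esym/quot_reprK.
rewrite /quot_add ![quot_repr (quot_proj x) + _]addrC.
by apply: reduce_classDl => //; apply/esym/quot_reprK.
Qed.

Lemma quot_proj_sigma x : quot_proj (sigma x) = quot_sigma (quot_proj x).
Proof.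
by apply: reduce_class_sigma => //; apply/esym/quot_reprK.
Qed.

Fact quot_addA : associative quot_add.
Proof.
elim/quot_proj_ind=> a; elim/quot_proj_ind=> b; elim/quot_proj_ind=> c.
by rewrite -!quot_projD addrA.
Qed.

Fact quot_addC : commutative quot_add.
Proof.
by elim/quot_proj_ind=> a; elim/quot_proj_ind=> b; rewrite -!quot_projD addrC.
Qed.

Fact quot_add0 : left_id (quot_proj 0) quot_add.
Proof. by elim/quot_proj_ind=> a; rewrite -quot_projD add0r. Qed.

HB.instance Definition _ := GRing.isNmodule.Build Q quot_addA quot_addC quot_add0.

Fact quot_addxx : idempotent_op (+%R : Q -> Q -> Q).
Proof. by elim/quot_proj_ind=> a; rewrite -[LHS]quot_projD addxx. Qed.

HB.instance Definition _ := Nmodule_isBModule.Build Q quot_addxx.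

Fact quot_sigma_nmod_morphism : nmod_morphism quot_sigma.
Proof.
split=> [|]; first by rewrite -[LHS]quot_proj_sigma sigma0.
elim/quot_proj_ind=> a; elim/quot_proj_ind=> b.
by rewrite -[_ + _]quot_projD -!quot_proj_sigma sigmaD quot_projD.
Qed.

Fact quot_sigmaK : involutive quot_sigma.
Proof. by elim/quot_proj_ind=> a; rewrite -!quot_proj_sigma sigmaK. Qed.

HB.instance Definition _ :=
  BModule_isSBModule.Build Q quot_sigma_nmod_morphism quot_sigmaK.

Fact quot_proj_nmod_morphism : nmod_morphism quot_proj.
Proof. by split=> // x y; exact: quot_projD. Qed.

HB.instance Definition _ :=
  GRing.isNmodMorphism.Build F Q quot_proj quot_proj_nmod_morphism.
HB.instance Definition _ := isSigmaEquivariant.Build F Q quot_proj quot_proj_sigma.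

(** * Isomorphism with the cokernel of the inclusion *)

Local Notation i := (@incl F E).

Lemma cokrel_quot_proj x y : cokrel i x y <-> quot_proj x = quot_proj y.
Proof.
split=> [/cokrelP xy|]; last exact: reduce_class_cokrel.
(* The quotient itself is the test object: for [u] in [E], both [u] and [sigma u] lie in [E] and
   have the same projection, so the class of [u] is fixed. *)
apply: (xy Q quot_proj) => -[u uE]; rewrite !inE /= -sigma_equivariant.
by apply/eqP/reduce_class_sbproj; rewrite ?mem_sigma ?sbproj_sigma.
Qed.

Definition coker_to_quot (c : coker i) : Q :=
  quot_proj (repr (c : {eq_quot (cokrel_equiv i)})).

Definition quot_to_coker (q : Q) : coker i := cokmap i (quot_repr q).

Lemma coker_to_quotE x : coker_to_quot (cokmap i x) = quot_proj x.
Proof. by apply/cokrel_quot_proj/cokmapP; rewrite cokmap_repr. Qed.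

Lemma quot_to_cokerE x : quot_to_coker (quot_proj x) = cokmap i x.
Proof. by apply/cokmapP/cokrel_quot_proj; rewrite quot_reprK. Qed.

Lemma coker_to_quotK : cancel coker_to_quot quot_to_coker.
Proof. by elim/cokmap_ind=> x; rewrite coker_to_quotE quot_to_cokerE. Qed.

Lemma quot_to_cokerK : cancel quot_to_coker coker_to_quot.
Proof. by elim/quot_proj_ind=> x; rewrite quot_to_cokerE coker_to_quotE. Qed.

Fact coker_to_quot_nmod_morphism : nmod_morphism coker_to_quot.
Proof.
split=> [|]; first exact: coker_to_quotE.
elim/cokmap_ind=> x; elim/cokmap_ind=> y.
by rewrite -raddfD !coker_to_quotE raddfD.
Qed.

Fact coker_to_quot_sigma : {morph coker_to_quot : c / sigma c}.
Proof.
elim/cokmap_ind=> x.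
by rewrite -sigma_equivariant !coker_to_quotE sigma_equivariant.
Qed.

HB.instance Definition _ := GRing.isNmodMorphism.Build (coker i) Q
  coker_to_quot coker_to_quot_nmod_morphism.
HB.instance Definition _ :=
  isSigmaEquivariant.Build (coker i) Q coker_to_quot coker_to_quot_sigma.

Fact quot_to_coker_nmod_morphism : nmod_morphism quot_to_coker.
Proof.
split=> [|]; first exact: quot_to_cokerE.
elim/quot_proj_ind=> x; elim/quot_proj_ind=> y.
by rewrite -raddfD !quot_to_cokerE raddfD.
Qed.

Fact quot_to_coker_sigma : {morph quot_to_coker : q / sigma q}.
Proof.
elim/quot_proj_ind=> x.
by rewrite -sigma_equivariant !quot_to_cokerE sigma_equivariant.
Qed.

HB.instance Definition _ := GRing.isNmodMorphism.Build Q (coker i)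
  quot_to_coker quot_to_coker_nmod_morphism.
HB.instance Definition _ :=
  isSigmaEquivariant.Build Q (coker i) quot_to_coker quot_to_coker_sigma.

End QuotientModule.

Theorem proposition1p8 (F : sbmodType) (E : sbSub F)
    (FsigmaE : {subset fixed F <= E}) :
  exists (C : SBModule (quot E)) (pi : sbHom F (SBModule.Pack C)),
    [/\ (forall (xi : F) (xiEc : xi \in fixedUcompl E),
           xi \notin E -> pi xi = quot_class (exist _ xi xiEc)),
        (forall (u : F) (puF : sbproj u \in fixedUcompl E),
           u \in E -> pi u = quot_class (exist _ (sbproj u) puF)),
        (forall q : quot E, exists x : F, pi x = q) &
        exists (phi : sbHom (coker (@incl F E)) (SBModule.Pack C))
               (psi : sbHom (SBModule.Pack C) (coker (@incl F E))),
          [/\ cancel phi psi, cancel psi phi &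
              forall x : F, phi (cokmap (@incl F E) x) = pi x]].
Proof.
(* The alias unfolds to [quot E], so its inferred structure is one on [quot E]. *)
exists (SBModule.class (cokernel_quot FsigmaE : sbmodType)).
exists (quot_proj FsigmaE : sbHom F (cokernel_quot FsigmaE)); split.
- by move=> xi xiEc _; rewrite quot_classE.
- move=> u puF uE; rewrite quot_classE.
  apply: reduce_class_sbproj; rewrite ?(sbproj_in FsigmaE) //=.
  by rewrite sbproj_idem.
- by move=> q; exists (quot_repr (q : cokernel_quot FsigmaE)); apply: quot_reprK.
- exists (@coker_to_quot F E FsigmaE : sbHom _ (cokernel_quot FsigmaE)).
  exists (@quot_to_coker F E FsigmaE : sbHom (cokernel_quot FsigmaE) _).
  split; [exact: coker_to_quotK|exact: quot_to_cokerK|exact: coker_to_quotE].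
Qed.
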